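(* For $\lambda\in[0,1/2]$, $\nu\ge\frac12-\lambda$ with $(\lambda,\nu)\ne(0,\tfrac12)$, and $x>0$, $$\frac{K_{\nu+1}(x)}{K_\nu(x)}<B\big(\alpha_\nu^{(K)}(\lambda),\beta_\nu^{(K)}(\lambda),1,x\big),$$ where $$\alpha_\nu^{(K)}(\lambda)=\nu+\tfrac12+\lambda,\qquad \beta_\nu^{(K)}(\lambda)=-\sqrt{2\lambda}+\sqrt{\nu^2-(\lambda-\tfrac12)^2}.$$
   Context: $K_\nu$ denotes the modified Bessel function of the second kind of real order $\nu$, and $B(\alpha,\beta,\gamma,x)=\dfrac{\alpha+\sqrt{\beta^2+\gamma^2x^2}}{x}$. *)

(* Defs.v *)
From HB Require Import structures.
From mathcomp Require Import all_boot all_order all_algebra.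
From mathcomp Require Import all_classical all_reals all_analysis.

Set Implicit Arguments.
Unset Strict Implicit.
Unset Printing Implicit Defensive.

Import Order.TTheory GRing.Theory Num.Theory.
Import numFieldNormedType.Exports.

Local Open Scope classical_set_scope.
Local Open Scope ring_scope.

Definition cosh {R : realType} (t : R) : R := (expR t + expR (- t)) / 2.

(* The modified Bessel function of the second kind of real order nu, given by
   its integral representation
     K_nu(x) = \int_0^oo exp(- x cosh t) cosh(nu t) dt,
   which is valid for every real order nu (integer or not) and every x > 0.
   For x > 0 the integrand is positive and decays doubly exponentially, so the
   Lebesgue integral is finite and its real-valued version is meaningful; for
   x <= 0 the value carries no meaning. *)
Definition besselK {R : realType} (nu x : R) : R :=
  \int[lebesgue_measure]_(t in `[0, +oo[) (expR (- (x * cosh t)) * cosh (nu * t)).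

Definition Bfun {R : realType} (alpha beta gamma x : R) : R :=
  (alpha + Num.sqrt (beta ^+ 2 + gamma ^+ 2 * x ^+ 2)) / x.

Definition alphaK {R : realType} (nu lambda : R) : R := nu + 1 / 2 + lambda.

Definition betaK {R : realType} (nu lambda : R) : R :=
  - Num.sqrt (2 * lambda) + Num.sqrt (nu ^+ 2 - (lambda - 1 / 2) ^+ 2).

(* Main.v *)
Require Import Defs.
From mathcomp Require Import all_boot all_order all_algebra.
From mathcomp Require Import all_classical all_reals all_analysis.
From mathcomp Require Import measurable_realfun ring lra.
Import Order.TTheory GRing.Theory Num.Theory.
Import numFieldNormedType.Exports.
Local Open Scope ring_scope.
Local Open Scope classical_set_scope.

(** Write [K_nu] for [besselK nu], [s x = sqrt (beta^2 + x^2)] and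
    [b = alpha + s], so that the bound is [b x / x]. The claim is that
    [W x = b x * K_nu x - x * K_(nu+1) x] is positive for all [x > 0].

    The two ladder relations [K_nu' = (nu/x) K_nu - K_(nu+1)] and
    [K_(nu+1)' = - ((nu+1)/x) K_(nu+1) - K_nu] show that [W] solves a linear
    equation [W' = a W - h] with [a = (b - nu) / x > 0] and
    [h = K_nu * (b^2 - 2 nu b - x^2 - x b') / x]. The parameters [alpha] and
    [beta] are exactly those for which the bracket becomes a square divided
    by [s]: with [p = sqrt (2 lambda)] it equals [(p s - beta)^2 / s]. Hence
    [h >= 0], and [h] has arbitrarily large points of positivity unless
    [p = beta = 0], that is, unless [(lambda, nu) = (0, 1/2)].

    The comparison principle [linear_ode_positive] then concludes. If
    [W x0 <= 0], the integrating factor [exp (- A)], [A' = a], keeps [W <= 0]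
    to the right of [x0]; then [W' <= 0] there, so [W] decreases. But
    [W >= - x K_(nu+1) x], which tends to 0 at infinity
    ([mul_besselK_small]). So [W] vanishes on [x0, oo), and then so does [h],
    a contradiction.

    The ladder relations ([is_derive_besselK_raise],
    [is_derive_besselK_lower]) are read off the integral representation: the
    derivative is taken under the integral sign ([is_derive_besselK]), and an
    integration of the derivative of [exp (- x cosh t) sinh (nu t)] gives the
    three-term recurrence ([besselK_recurrence]). Every integrand involved is
    dominated by a multiple of [exp (- t)] ([kernel_le_expRN]). *)

(** * A comparison principle for linear differential equations *)

Lemma derivable_continuousR (R : realType) (f : R -> R) :
  (forall x, derivable f x 1) -> continuous f.
Proof.
by move=> df x; apply/differentiable_continuous/derivable1_diffP/df.
Qed.

(** Without the tail hypothesis the conclusion fails: a negative solution of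
    [W' = a W - h] runs away to lower values. A solution that does not stay
    below some negative number near infinity therefore has to be
    nonnegative, and the points where [h] is positive exclude its zeros. *)
Lemma linear_ode_positive (R : realType) (W A a h : R -> R) :
  (forall x : R, 0 < x -> is_derive x 1 A (a x)) ->
  (forall x : R, 0 < x -> is_derive x 1 W (a x * W x - h x)) ->
  (forall x : R, 0 < x -> 0 <= a x) ->
  (forall x : R, 0 < x -> 0 <= h x) ->
  (forall x : R, 0 < x -> exists2 y, x < y & 0 < h y) ->
  (forall x e : R, 0 < e -> exists2 y, x < y & - e < W y) ->
  forall x : R, 0 < x -> 0 < W x.
Proof.
move=> dA dW a0 h0 hpos Wtail x0 x0gt0; rewrite ltNge; apply/negP => Wx0.
have decr (f df : R -> R) : (forall x : R, 0 < x -> is_derive x 1 f (df x)) ->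
    (forall x, x0 < x -> df x <= 0) ->
    forall x y, x0 <= x -> x <= y -> f y <= f x.
  move=> dF df0; apply: ler0_derive1_nincry.
  - move=> x; rewrite in_itv/= andbT => x0x.
    exact: (@ex_derive _ _ _ _ _ _ _ (dF x (lt_trans x0gt0 x0x))).
  - move=> x; rewrite in_itv/= andbT => x0x; rewrite derive1E.
    by rewrite (@derive_val _ _ _ _ _ _ _ (dF x (lt_trans x0gt0 x0x))) df0.
  - apply: derivable_within_continuous => x; rewrite in_itv/= andbT => x0x.
    exact: (@ex_derive _ _ _ _ _ _ _ (dF x (lt_le_trans x0gt0 x0x))).
(* [exp (- A) W] has derivative [- exp (- A) h], hence decreases. *)
have W0 x : x0 <= x -> W x <= 0.
  move=> x0x; rewrite -(pmulr_rle0 _ (expR_gt0 (- A x))).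
  apply: (@le_trans _ _ (expR (- A x0) * W x0)); last first.
    by rewrite pmulr_rle0// expR_gt0.
  apply: (decr (fun y => expR (- A y) * W y)
    (fun y => - (expR (- A y) * h y))) => //.
    move=> y y0; have dAy := dA y y0; have dWy := dW y y0.
    have dNA : is_derive y 1 (fun z => - A z) (- a y) by apply: is_deriveN.
    have dE := @is_derive1_comp _ expR _ y _ _ (is_derive_expR _) dNA.
    apply: is_derive_eq (is_deriveM dE dWy) _.
    by rewrite /= /GRing.scale/=; ring.
  by move=> y x0y; rewrite oppr_le0 mulr_ge0 ?expR_ge0// h0// (lt_trans x0gt0).
have Wdecr : forall x y, x0 <= x -> x <= y -> W y <= W x.
  apply: decr dW _ => x x0x; have xgt0 := lt_trans x0gt0 x0x.
  rewrite subr_le0 (le_trans _ (h0 x xgt0))// mulr_ge0_le0 ?a0//.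
  by rewrite W0// ltW.
have WE x : x0 <= x -> W x = 0.
  move=> x0x; apply/eqP; rewrite eq_le W0//= leNgt; apply/negP => Wx.
  have [|y xy] := Wtail x (- W x); first by rewrite oppr_gt0.
  by rewrite opprK ltNge Wdecr// ltW.
(* At a point [y] with [h y > 0], [W] has a local maximum, being zero there;
   but its derivative is [- h y]. *)
have [y x0y hy] := hpos x0 x0gt0.
have ygt0 := lt_trans x0gt0 x0y.
have dWy0 : is_derive y 1 W 0.
  apply: (@derive1_at_max _ W x0 (y + 1)).
  - by rewrite (le_trans (ltW x0y))// lerDl.
  - move=> t; rewrite in_itv/= => /andP[x0t _].
    exact: (@ex_derive _ _ _ _ _ _ _ (dW t (lt_trans x0gt0 x0t))).
  - by rewrite in_itv/= x0y ltrDl ltr01.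
  - move=> t; rewrite in_itv/= => /andP[x0t _].
    by rewrite (WE y (ltW x0y)) W0// ltW.
have := @derive_val _ _ _ _ _ _ _ (dW y ygt0).
rewrite (@derive_val _ _ _ _ _ _ _ dWy0).
rewrite (WE y (ltW x0y)) mulr0 sub0r => /eqP.
by rewrite eq_sym oppr_eq0 gt_eqF.
Qed.

(** * The square root in the bound and the integrating factor *)

(** The factor [1 ^+ 2] makes the radicand that of [Bfun] at [gamma = 1]. *)
Lemma is_derive_sqrt_sqrD (R : realType) (beta x : R) : 0 < x ->
  is_derive x 1 (fun y => Num.sqrt (beta ^+ 2 + 1 ^+ 2 * y ^+ 2))
    (x / Num.sqrt (beta ^+ 2 + 1 ^+ 2 * x ^+ 2)).
Proof.
move=> x0.
have s0 : 0 < beta ^+ 2 + 1 ^+ 2 * x ^+ 2.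
  by rewrite expr1n mul1r ltr_wpDl ?sqr_ge0// exprn_gt0.
have dI : is_derive x (1 : R) (fun y => beta ^+ 2 + 1 ^+ 2 * y ^+ 2) (2 * x).
  by apply: is_derive_eq; rewrite /GRing.scale/=; ring.
apply: is_derive_eq (@is_derive1_comp _ _ _ x _ _ (is_derive1_sqrt s0) dI) _.
have ? : Num.sqrt (beta ^+ 2 + 1 ^+ 2 * x ^+ 2) != 0 by rewrite gt_eqF// sqrtr_gt0.
by field.
Qed.

(** The integrating factor for the comparison principle: [(s + c) / x] has an
    elementary antiderivative because
    [x / (beta + s) = (s - beta) / x], which is [s^2 - beta^2 = x^2]. *)
Lemma is_derive_integrating_exponent (R : realType) (beta c x : R) : 0 < x ->
  let s y := Num.sqrt (beta ^+ 2 + 1 ^+ 2 * y ^+ 2) in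
  is_derive x 1
    (fun y => s y - beta * (ln (beta + s y) - ln y) + c * ln y)
    ((s x + c) / x).
Proof.
move=> x0 s; have ds := is_derive_sqrt_sqrD R beta x x0.
rewrite -/(s x) in ds.
have sE : s x ^+ 2 = beta ^+ 2 + x ^+ 2.
  by rewrite sqr_sqrtr expr1n mul1r// addr_ge0// sqr_ge0.
have s0 : 0 < s x.
  by rewrite sqrtr_gt0 expr1n mul1r ltr_wpDl ?sqr_ge0// exprn_gt0.
have bs0 : 0 < beta + s x.
  have : `|beta| < s x.
    rewrite -sqrtr_sqr ltr_sqrt expr1n mul1r ?ltrDl ?exprn_gt0//.
    by rewrite ltr_wpDl ?sqr_ge0// exprn_gt0.
  by have := ler_norm (- beta); rewrite normrN; lra.
have dI : is_derive x 1 (fun y => beta + s y) (x / s x).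
  by apply: is_derive_eq (is_deriveD (is_derive_cst beta x 1) ds) _; rewrite add0r.
have dL := @is_derive1_comp _ _ _ x _ _ (is_derive1_ln bs0) dI.
have dl := is_derive1_ln x0.
apply: is_derive_eq (is_deriveD (is_deriveB ds (is_deriveZ beta (is_deriveB dL dl)))
  (is_deriveZ c dl)) _.
have key : x / (beta + s x) = (s x - beta) / x.
  apply/eqP; rewrite (eqr_div _ _ (lt0r_neq0 bs0) (lt0r_neq0 x0)).
  apply/eqP.
  by transitivity (s x ^+ 2 - beta ^+ 2); [rewrite sE|]; ring.
transitivity (x / (beta + s x) + beta / x + c / x).
  by rewrite /GRing.scale/=; field; rewrite !gt_eqF.
by rewrite key; field; rewrite gt_eqF.
Qed.

(** * Hyperbolic functions and their bounds *)

Definition sinh {R : realType} (t : R) : R := (expR t - expR (- t)) / 2.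

Lemma is_derive_expRM (R : realType) (c t : R) :
  is_derive t 1 (fun u => expR (c * u)) (c * expR (c * t)).
Proof.
have dI : is_derive t (1 : R) (fun u => c * u) c.
  by apply: is_derive_eq; rewrite /GRing.scale/= mulr1.
by apply: is_derive_eq (@is_derive1_comp _ _ _ t _ _ (is_derive_expR _) dI) _;
  rewrite mulrC.
Qed.

Lemma is_derive_expRN (R : realType) (t : R) :
  is_derive t 1 (fun u => expR (- u)) (- expR (- t)).
Proof.
have := is_derive_expRM R (-1) t; rewrite !mulN1r.
by under eq_fun do rewrite mulN1r.
Qed.

Lemma is_derive_cosh (R : realType) (nu t : R) :
  is_derive t 1 (fun u => cosh (nu * u)) (nu * sinh (nu * t)).
Proof.
have dp := is_derive_expRM R nu t; have dn := is_derive_expRM R (- nu) t.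
rewrite (_ : (fun u => _) =
    (fun u => 2^-1 * (expR (nu * u) + expR (- nu * u)))); last first.
  by apply/funext => u; rewrite /cosh mulNr mulrC.
apply: is_derive_eq (is_deriveZ 2^-1 (is_deriveD dp dn)) _.
by rewrite /GRing.scale/= /sinh !mulNr; field.
Qed.

Lemma is_derive_sinh (R : realType) (nu t : R) :
  is_derive t 1 (fun u => sinh (nu * u)) (nu * cosh (nu * t)).
Proof.
have dp := is_derive_expRM R nu t; have dn := is_derive_expRM R (- nu) t.
rewrite (_ : (fun u => _) =
    (fun u => 2^-1 * (expR (nu * u) - expR (- nu * u)))); last first.
  by apply/funext => u; rewrite /sinh mulNr mulrC.
apply: is_derive_eq (is_deriveZ 2^-1 (is_deriveB dp dn)) _.
by rewrite /GRing.scale/= /cosh !mulNr; field.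
Qed.

Lemma cosh_gt0 (R : realType) (t : R) : 0 < cosh t.
Proof. by rewrite divr_gt0// addr_gt0// expR_gt0. Qed.

Lemma cosh_ge1 (R : realType) (t : R) : 1 <= cosh t.
Proof.
rewrite /cosh ler_pdivlMr// mul1r.
by have := expR_ge1Dx t; have := expR_ge1Dx (- t); lra.
Qed.

Lemma cosh_ge_sqr (R : realType) (t : R) : 0 <= t -> t ^+ 2 / 4 <= cosh t.
Proof.
move=> t0; have := expR_ge1Dxn 1 t0; have := expR_gt0 (- t).
rewrite /cosh (_ : 2`!%:R = 2 :> R)//; have := sqr_ge0 t; lra.
Qed.

Lemma expRM_le_norm (R : realType) (nu t : R) : 0 <= t ->
  expR (nu * t) <= expR (`|nu| * t).
Proof. by move=> t0; rewrite ler_expR ler_wpM2r// ler_norm. Qed.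

Lemma cosh_le_expR (R : realType) (nu t : R) : 0 <= t ->
  `|cosh (nu * t)| <= expR (`|nu| * t).
Proof.
move=> t0; rewrite (ger0_norm (ltW (cosh_gt0 _ _))) /cosh -mulNr.
have := expRM_le_norm R nu t t0; have := expRM_le_norm R (- nu) t t0.
by rewrite normrN => *; lra.
Qed.

Lemma sinh_le_expR (R : realType) (nu t : R) : 0 <= t ->
  `|sinh (nu * t)| <= expR (`|nu| * t).
Proof.
move=> t0; rewrite /sinh -mulNr ler_norml.
have := expRM_le_norm R nu t t0; have := expRM_le_norm R (- nu) t t0.
have := expR_gt0 (nu * t); have := expR_gt0 (- nu * t).
by rewrite normrN => *; apply/andP; split; lra.
Qed.

(** The quadratic minorant of [cosh] suffices: completing the square,
    [(c + 1) t - x t^2 / 4 <= (c + 1)^2 / x]. *)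
Lemma kernel_le_expRN (R : realType) (x c t : R) : 0 < x -> 0 <= t ->
  expR (- (x * cosh t)) * expR (c * t) <= expR ((c + 1) ^+ 2 / x) * expR (- t).
Proof.
move=> x0 t0; rewrite -!expRD ler_expR.
apply: (@le_trans _ _ (- (x * (t ^+ 2 / 4)) + c * t)).
  by rewrite lerD2r lerN2 ler_pM2l// cosh_ge_sqr.
rewrite -subr_ge0 (_ : _ - _ = ((c + 1) / x - t / 2) ^+ 2 * x).
  by rewrite mulr_ge0 ?sqr_ge0// ltW.
by field; rewrite gt_eqF.
Qed.

(** * Integrals over the half-line dominated by an exponential *)

Section integrals.
Context {R : realType}.
Notation mu := (@lebesgue_measure R).
Local Notation halfline := (`[0%R, +oo[%classic : set R).

Let cvg_expRNC (C : R) : C * expR (- t) @[t --> +oo] --> 0.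
Proof. by rewrite -(mulr0 C); apply: cvgM; [exact: cvg_cst|exact: cvgr_expR]. Qed.

Lemma cvg0_le_expRN (f : R -> R) (C : R) :
  (forall t, 0 <= t -> `|f t| <= C * expR (- t)) -> f t @[t --> +oo] --> 0.
Proof.
move=> fC; apply: squeeze_cvgr (cvg_expRNC (- C)) (cvg_expRNC C).
by near=> t; rewrite mulNr -ler_norml; exact: fC.
Unshelve. all: by end_near. Qed.

Lemma ge0_integral_derive (f F : R -> R) (l : R) :
  (forall t, 0 <= t -> 0 <= f t) -> (forall t : R, is_derive t 1 F (f t)) ->
  continuous f -> F t @[t --> +oo] --> l ->
  (\int[mu]_(t in halfline) (f t)%:E = (l - F 0)%:E)%E.
Proof.
move=> f0 dF cf Fl; rewrite EFinB; apply: ge0_continuous_FTC2y => //.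
- exact: continuous_subspaceT.
- apply/cvg_at_right_filter; apply: derivable_continuousR => t.
  exact: (@ex_derive _ _ _ _ _ _ _ (dF t)).
- by move=> t _; rewrite derive1E (@derive_val _ _ _ _ _ _ _ (dF t)).
Qed.

Let is_derive_NexpRN (C t : R) :
  is_derive t 1 (fun u => - (C * expR (- u))) (C * expR (- t)).
Proof.
apply: is_derive_eq (is_deriveN (is_deriveZ C (is_derive_expRN R t))) _.
by rewrite /GRing.scale/=; ring.
Qed.

Let continuous_CexpRN (C : R) : continuous (fun t => C * expR (- t)).
Proof.
apply: derivable_continuousR => t.
exact: (@ex_derive _ _ _ _ _ _ _ (is_deriveZ C (is_derive_expRN R t))).
Qed.

Lemma integral_CexpRN (C : R) : 0 <= C ->
  (\int[mu]_(t in halfline) (C * expR (- t))%:E = C%:E)%E.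
Proof.
move=> C0; have f0 t : 0 <= t -> 0 <= C * expR (- t).
  by move=> _; rewrite mulr_ge0// expR_ge0.
have Fl : - (C * expR (- t)) @[t --> +oo] --> 0.
  by rewrite -oppr0; apply: cvgN; exact: cvg_expRNC.
rewrite (ge0_integral_derive _ _ _ f0 (is_derive_NexpRN C)
  (continuous_CexpRN C) Fl).
by rewrite /= oppr0 expR0 mulr1 sub0r opprK.
Qed.

Lemma integrable_le_expRN (f : R -> R) (C : R) : continuous f ->
  (forall t, 0 <= t -> `|f t| <= C * expR (- t)) ->
  mu.-integrable halfline (EFin \o f).
Proof.
move=> cf fC.
have C0 : 0 <= C.
  by have := fC 0 (lexx _); rewrite oppr0 expR0 mulr1; exact: le_trans.
have mfun (g : R -> R) : continuous g -> measurable_fun halfline g.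
  move=> cg; apply/measurable_funTS.
  exact: continuous_measurable_fun.
have intC : mu.-integrable halfline (EFin \o (fun t => C * expR (- t))).
  apply/integrableP; split.
    by apply/measurable_EFinP; apply: mfun; exact: continuous_CexpRN.
  under eq_integral do rewrite /= ger0_norm ?mulr_ge0 ?expR_ge0//.
  by rewrite integral_CexpRN// ltry.
apply: le_integrable intC => //; first by apply/measurable_EFinP; exact: mfun.
move=> t /=; rewrite in_itv/= andbT => t0; rewrite lee_fin.
by rewrite (le_trans (fC t t0))// ler_norm.
Qed.

(** For a nonnegative integrand the fundamental theorem of calculus passes to
    the half-line by monotone convergence. A signed integrand dominated by
    [C * expR (- t)] is reduced to this case by adding [C * expR (- t)] to it and
    [- C * expR (- t)] to its primitive. *)
Lemma Rintegral_derive (f F : R -> R) (C l : R) :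
  (forall t : R, is_derive t 1 F (f t)) -> continuous f ->
  (forall t, 0 <= t -> `|f t| <= C * expR (- t)) ->
  F t @[t --> +oo] --> l ->
  \int[mu]_(t in halfline) f t = l - F 0.
Proof.
move=> dF cf fC Fl.
have C0 : 0 <= C.
  by have := fC 0 (lexx _); rewrite oppr0 expR0 mulr1; exact: le_trans.
have intf := integrable_le_expRN f C cf fC.
have intC : mu.-integrable halfline (EFin \o (fun t => C * expR (- t))).
  apply: (integrable_le_expRN _ C); first exact: continuous_CexpRN.
  by move=> t _; rewrite ger0_norm// mulr_ge0// expR_ge0.
have fCE : \int[mu]_(t in halfline) (f t + C * expR (- t)) = l - F 0 + C.
  have f0 t : 0 <= t -> 0 <= f t + C * expR (- t).
    by move=> /fC; rewrite ler_norml => /andP[]; lra.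
  have cfC : continuous (fun t => f t + C * expR (- t)).
    by move=> t; apply: cvgD; [exact: cf|exact: continuous_CexpRN].
  have FCl : F t - C * expR (- t) @[t --> +oo] --> l.
    by rewrite -[l in X in _ --> X]subr0; apply: cvgB => //; exact: cvg_expRNC.
  have dFC (t : R) : is_derive t 1 (fun u => F u - C * expR (- u))
      (f t + C * expR (- t)) := is_deriveD (dF t) (is_derive_NexpRN C t).
  rewrite /Rintegral (ge0_integral_derive _ _ _ f0 dFC cfC FCl)/=.
  by rewrite oppr0 expR0 mulr1; lra.
rewrite RintegralD// in fCE.
have CE : \int[mu]_(t in halfline) (C * expR (- t)) = C.
  by rewrite /Rintegral integral_CexpRN.
by move: fCE; rewrite CE => /addIr.
Qed.

End integrals.

(** * Differential and recurrence relations of the Bessel function *)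

Lemma cosh_coshM (R : realType) (nu t : R) :
  cosh t * cosh (nu * t) = (cosh ((nu + 1) * t) + cosh ((nu - 1) * t)) / 2.
Proof.
rewrite /cosh !mulrDl !mulN1r !mul1r !opprD !opprK !expRD.
by field.
Qed.

Lemma sinh_sinhM (R : realType) (nu t : R) :
  sinh t * sinh (nu * t) = (cosh ((nu + 1) * t) - cosh ((nu - 1) * t)) / 2.
Proof.
rewrite /cosh /sinh !mulrDl !mulN1r !mul1r !opprD !opprK !expRD.
by field.
Qed.

Section besselK_theory.
Context {R : realType}.
Notation mu := (@lebesgue_measure R).
Local Notation halfline := (`[0%R, +oo[%classic : set R).
Implicit Types (nu x c t z : R) (g : R -> R).

Lemma kernelM_le_expRN g c x t : 0 < x -> 0 <= t ->
  `|g t| <= expR (c * t) ->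
  `|expR (- (x * cosh t)) * g t| <= expR ((c + 1) ^+ 2 / x) * expR (- t).
Proof.
move=> x0 t0 gt; apply: le_trans (kernel_le_expRN R x c t x0 t0).
by rewrite normrM (ger0_norm (expR_ge0 _)) ler_wpM2l// expR_ge0.
Qed.

Lemma is_derive_kernel x t :
  is_derive t 1 (fun u => expR (- (x * cosh u)))
    (- (x * sinh t) * expR (- (x * cosh t))).
Proof.
have dc : is_derive t 1 (fun u => - (x * cosh (1 * u))) (- (x * sinh t)).
  apply: is_derive_eq (is_deriveN (is_deriveZ x (is_derive_cosh R 1 t))) _.
  by rewrite /GRing.scale/= !mul1r.
have dE := @is_derive1_comp _ _ _ t _ _ (is_derive_expR _) dc.
rewrite (_ : (fun u => _) = expR \o (fun u => - (x * cosh (1 * u)))).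
  by apply: is_derive_eq dE _; rewrite /= mul1r mulrC.
by apply/funext => u /=; rewrite mul1r.
Qed.

Lemma continuous_kernelM g x : continuous g ->
  continuous (fun t => expR (- (x * cosh t)) * g t).
Proof.
have ck : continuous (fun u => expR (- (x * cosh u))).
  apply: derivable_continuousR => u.
  exact: (@ex_derive _ _ _ _ _ _ _ (is_derive_kernel x u)).
by move=> cg t; apply: cvgM; [exact: ck|exact: cg].
Qed.

Lemma integrable_kernelM g c x : 0 < x -> continuous g ->
  (forall t, 0 <= t -> `|g t| <= expR (c * t)) ->
  mu.-integrable halfline (EFin \o (fun t => expR (- (x * cosh t)) * g t)).
Proof.
move=> x0 cg gc; apply: (integrable_le_expRN _ (expR ((c + 1) ^+ 2 / x))).
  exact: continuous_kernelM.
by move=> t t0; apply: kernelM_le_expRN => //; exact: gc.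
Qed.

Lemma continuous_cosh nu : continuous (fun t => cosh (nu * t)).
Proof.
apply: derivable_continuousR => t.
exact: (@ex_derive _ _ _ _ _ _ _ (is_derive_cosh R nu t)).
Qed.

Lemma continuous_sinh nu : continuous (fun t => sinh (nu * t)).
Proof.
apply: derivable_continuousR => t.
exact: (@ex_derive _ _ _ _ _ _ _ (is_derive_sinh R nu t)).
Qed.

Lemma integrable_besselK nu x : 0 < x ->
  mu.-integrable halfline
    (EFin \o (fun t => expR (- (x * cosh t)) * cosh (nu * t))).
Proof.
move=> x0; apply: (integrable_kernelM _ `|nu|) => //.
  exact: continuous_cosh.
by move=> t; exact: cosh_le_expR.
Qed.

Lemma cosh_coshM_le_expR nu t : 0 <= t ->
  `|cosh t * cosh (nu * t)| <= expR ((1 + `|nu|) * t).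
Proof.
move=> t0; rewrite normrM mulrDl expRD.
have c1 := cosh_le_expR R 1 t t0; rewrite normr1 !mul1r in c1.
by rewrite mul1r; apply: ler_pM c1 (cosh_le_expR R nu t t0); rewrite normr_ge0.
Qed.

(** Differentiation under the integral sign on [x/2, 2x]: there the
    [x]-derivative of the integrand is dominated by its value at [x/2]. The
    factor [- cosh t] that it produces shifts the order by
    [2 cosh t cosh (nu t) = cosh ((nu+1) t) + cosh ((nu-1) t)]. *)
Lemma is_derive_besselK nu x : 0 < x ->
  is_derive x 1 (besselK nu)
    (- ((besselK (nu + 1) x + besselK (nu - 1) x) / 2)).
Proof.
move=> x0.
pose f z t : R := expR (- (z * cosh t)) * cosh (nu * t).
pose G t : R := expR (- (x / 2 * cosh t)) * (cosh t * cosh (nu * t)).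
have df z t : is_derive z 1 (f^~ t)
    (- (expR (- (z * cosh t)) * (cosh t * cosh (nu * t)))).
  rewrite (_ : f^~ t = (fun y => cosh (nu * t) * expR (- cosh t * y))).
    apply: is_derive_eq (is_deriveZ _ (is_derive_expRM R (- cosh t) z)) _.
    rewrite (_ : - cosh t * z = - (z * cosh t)); last by ring.
    by rewrite /GRing.scale/=; ring.
  by apply/funext => y; rewrite /f mulNr [y * _]mulrC [RHS]mulrC.
have intI z : `](x / 2), (x * 2)[%classic z ->
    mu.-integrable halfline (EFin \o f z).
  rewrite /= in_itv/= => /andP[xz _]; apply: integrable_besselK.
  by rewrite (lt_trans _ xz)// divr_gt0.
have derf z t : `](x / 2), (x * 2)[%classic z -> halfline t ->
    derivable (f^~ t) z 1.
  by move=> _ _; exact: (@ex_derive _ _ _ _ _ _ _ (df z t)).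
have G0 t : 0 <= G t.
  by rewrite mulr_ge0 ?expR_ge0// mulr_ge0// ltW// cosh_gt0.
have ccosh : continuous (fun t => cosh t * cosh (nu * t)).
  have c1 : continuous (@cosh R).
    rewrite (_ : cosh = (fun t => cosh (1 * t))); first exact: continuous_cosh.
    by apply/funext => t; rewrite mul1r.
  by move=> t; apply: cvgM; [exact: c1|exact: continuous_cosh].
have intG : mu.-integrable halfline (EFin \o G).
  apply: (integrable_kernelM _ (1 + `|nu|)) => //; first by rewrite divr_gt0.
  by move=> t; exact: cosh_coshM_le_expR.
have fG z t : `](x / 2), (x * 2)[%classic z -> halfline t ->
    `|partial1of2 f z t| <= G t.
  rewrite /= in_itv/= => /andP[xz _] _.
  rewrite partial1of2E (@derive_val _ _ _ _ _ _ _ (df z t)) normrN.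
  have c0 : 0 <= cosh t * cosh (nu * t) by rewrite mulr_ge0// ltW// cosh_gt0.
  rewrite ger0_norm ?mulr_ge0 ?expR_ge0// ler_wpM2r// ler_expR lerN2.
  by rewrite ler_wpM2r// ltW// cosh_gt0.
have Ix : `](x / 2), (x * 2)[%classic x by rewrite /= in_itv/=; apply/andP; split; lra.
have dK : derivable (besselK nu) x 1.
  exact: (derivable_under_integral _ Ix intI derf G0 intG fG).
have KE := differentiation_under_integral _ Ix intI derf G0 intG fG.
apply: DeriveDef; first exact: dK.
pose a t : R := expR (- (x * cosh t)) * cosh ((nu + 1) * t).
pose b t : R := expR (- (x * cosh t)) * cosh ((nu - 1) * t).
have ia : mu.-integrable halfline (EFin \o a) by exact: integrable_besselK.
have ib : mu.-integrable halfline (EFin \o b) by exact: integrable_besselK.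
have iab : mu.-integrable halfline (EFin \o (fun t => a t + b t)).
  exact: (integrableD _ ia ib).
rewrite -derive1E [LHS]KE// (@eq_Rintegral _ _ _ mu halfline
  (fun t => - 2^-1 * (a t + b t))).
  rewrite RintegralZl// RintegralD//.
  rewrite -[\int[mu]_(t in _) a t]/(besselK (nu + 1) x).
  rewrite -[\int[mu]_(t in _) b t]/(besselK (nu - 1) x).
  by rewrite mulNr mulrC.
move=> t _; rewrite partial1of2E (@derive_val _ _ _ _ _ _ _ (df x t)).
by rewrite cosh_coshM /a /b; lra.
Qed.

(** The function [exp (- x cosh t) sinh (nu t)] vanishes at 0 and at infinity,
    so its derivative integrates to zero. That derivative has the part
    [nu exp (- x cosh t) cosh (nu t)] and the part
    [- x exp (- x cosh t) sinh t sinh (nu t)], and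
    [2 sinh t sinh (nu t) = cosh ((nu+1) t) - cosh ((nu-1) t)]. *)
Lemma besselK_recurrence nu x : 0 < x ->
  x * (besselK (nu + 1) x - besselK (nu - 1) x) = 2 * nu * besselK nu x.
Proof.
move=> x0.
pose a t : R := expR (- (x * cosh t)) * cosh ((nu + 1) * t).
pose b t : R := expR (- (x * cosh t)) * cosh ((nu - 1) * t).
pose k t : R := expR (- (x * cosh t)) * cosh (nu * t).
have ia : mu.-integrable halfline (EFin \o a) by exact: integrable_besselK.
have ib : mu.-integrable halfline (EFin \o b) by exact: integrable_besselK.
have ik : mu.-integrable halfline (EFin \o k) by exact: integrable_besselK.
have iab : mu.-integrable halfline (EFin \o (fun t => a t - b t)).
  exact: (integrableB _ ia ib).
have iZk : mu.-integrable halfline (EFin \o (fun t => nu * k t)).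
  exact: (integrableZl _ _ ik).
have iZab : mu.-integrable halfline (EFin \o (fun t => x / 2 * (a t - b t))).
  exact: (integrableZl _ _ iab).
pose F t : R := expR (- (x * cosh t)) * sinh (nu * t).
pose f t : R := nu * k t - x / 2 * (a t - b t).
have dF t : is_derive t 1 F (f t).
  apply: is_derive_eq (is_deriveM (is_derive_kernel x t) (is_derive_sinh R nu t)) _.
  rewrite /GRing.scale/= /f /k.
  transitivity (nu * (expR (- (x * cosh t)) * cosh (nu * t)) -
    x * expR (- (x * cosh t)) * (sinh t * sinh (nu * t))); first by ring.
  by rewrite sinh_sinhM /a /b; field.
have cf : continuous f.
  have cg g : continuous g -> continuous (fun t => expR (- (x * cosh t)) * g t).
    exact: continuous_kernelM.
  move=> t; apply: cvgB; apply: cvgM; try exact: cvg_cst.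
    exact/cg/continuous_cosh.
  by apply: cvgB; apply: cg; exact: continuous_cosh.
pose Ck c := expR ((`|c| + 1) ^+ 2 / x).
have kC c t : 0 <= t ->
    `|expR (- (x * cosh t)) * cosh (c * t)| <= Ck c * expR (- t).
  move=> t0; apply: (kernelM_le_expRN (fun t => cosh (c * t))) => //.
  exact: cosh_le_expR.
have fC t : 0 <= t -> `|f t| <= (`|nu| * Ck nu +
    x / 2 * (Ck (nu + 1) + Ck (nu - 1))) * expR (- t).
  move=> t0; rewrite /f mulrDl; apply: le_trans (ler_normB _ _) _.
  apply: lerD; rewrite normrM -[leRHS]mulrA; first by rewrite ler_wpM2l// kC.
  rewrite ger0_norm; last by rewrite divr_ge0// ltW.
  rewrite ler_wpM2l ?divr_ge0 ?(ltW x0)//.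
  by rewrite mulrDl; apply: le_trans (ler_normB _ _) _; apply: lerD; exact: kC.
have F0 : F t @[t --> +oo] --> 0.
  apply: (cvg0_le_expRN _ (Ck nu)) => t t0.
  apply: (kernelM_le_expRN (fun t => sinh (nu * t))) => //.
  exact: sinh_le_expR.
have FE := Rintegral_derive _ _ _ _ dF cf fC F0.
have F00 : F 0 = 0 by rewrite /F mulr0 /sinh oppr0 subrr mul0r mulr0.
rewrite F00 subr0 RintegralB// RintegralZl// RintegralZl// RintegralB// in FE.
rewrite -[\int[mu]_(t in _) a t]/(besselK (nu + 1) x) in FE.
rewrite -[\int[mu]_(t in _) b t]/(besselK (nu - 1) x) in FE.
rewrite -[\int[mu]_(t in _) k t]/(besselK nu x) in FE.
by move: (besselK _ _) (besselK _ _) (besselK _ _) FE => *; lra.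
Qed.

Lemma is_derive_besselK_raise nu x : 0 < x ->
  is_derive x 1 (besselK nu) (nu / x * besselK nu x - besselK (nu + 1) x).
Proof.
move=> x0; have xn : x != 0 by rewrite gt_eqF.
have rec := besselK_recurrence nu x x0.
apply: is_derive_eq (is_derive_besselK nu x x0) _.
rewrite (_ : nu / x * besselK nu x = 2 * nu * besselK nu x / (2 * x)).
  by rewrite -rec; move: (besselK _ _) (besselK _ _) => ? ?; field.
by move: (besselK _ _) => ?; field.
Qed.

Lemma is_derive_besselK_lower nu x : 0 < x ->
  is_derive x 1 (besselK nu) (- (nu / x * besselK nu x) - besselK (nu - 1) x).
Proof.
move=> x0; have xn : x != 0 by rewrite gt_eqF.
have rec := besselK_recurrence nu x x0.
apply: is_derive_eq (is_derive_besselK nu x x0) _.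
rewrite (_ : nu / x * besselK nu x = 2 * nu * besselK nu x / (2 * x)).
  by rewrite -rec; move: (besselK _ _) (besselK _ _) => ? ?; field.
by move: (besselK _ _) => ?; field.
Qed.

End besselK_theory.

(** * Positivity and decay of the Bessel function *)

Section besselK_size.
Context {R : realType}.
Notation mu := (@lebesgue_measure R).
Local Notation halfline := (`[0%R, +oo[%classic : set R).
Implicit Types (nu x y t : R).

(** The integrand dominates [x sinh t exp (- 2 x cosh t)], since
    [x sinh t <= exp (x cosh t)]; this minorant has the primitive
    [- exp (- 2 x cosh t) / 2] and so the positive integral
    [exp (- 2 x) / 2]. *)
Lemma besselK_gt0 nu x : 0 < x -> 0 < besselK nu x.
Proof.
move=> x0.
pose L t : R := x * sinh t * expR (- (x * 2 * cosh t)).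
pose F t : R := - 2^-1 * expR (- (x * 2 * cosh t)).
have dF t : is_derive t 1 F (L t).
  apply: is_derive_eq (is_deriveZ (- 2^-1) (is_derive_kernel (x * 2) t)) _.
  by rewrite /GRing.scale/= /L; field.
have Lle t : 0 <= t -> 0 <= L t <= expR (- (x * cosh t)).
  move=> t0; have s0 : 0 <= sinh t.
    by rewrite divr_ge0// subr_ge0 ler_expR; lra.
  have sc : sinh t <= cosh t.
    by rewrite ler_pM2r ?invr_gt0//; have := expR_gt0 (- t); lra.
  rewrite /L; apply/andP; split; first by rewrite mulr_ge0 ?expR_ge0// mulr_ge0// ltW.
  rewrite (_ : - (x * 2 * cosh t) = - (x * cosh t) - x * cosh t); last by ring.
  rewrite expRD mulrA ger_pMl ?expR_gt0// expRN.
  rewrite ler_pdivrMr ?expR_gt0// mul1r.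
  apply: (@le_trans _ _ (x * cosh t)); first by rewrite ler_pM2l.
  by rewrite (le_trans _ (expR_ge1Dx _))// lerDr.
have kC y t : 0 < y -> 0 <= t ->
    `|expR (- (y * cosh t)) * 1| <= expR ((0 + 1) ^+ 2 / y) * expR (- t).
  move=> y0 t0; apply: (kernelM_le_expRN (fun=> 1)) => //.
  by rewrite mul0r expR0 normr1.
have cL : continuous L.
  have c1 : continuous (@sinh R).
    rewrite (_ : sinh = (fun t => sinh (1 * t))); first exact: continuous_sinh.
    by apply/funext => t; rewrite mul1r.
  have cs : continuous (fun t : R => x * sinh t).
    by move=> t; apply: cvgM; [exact: cvg_cst|exact: c1].
  rewrite (_ : L = (fun t => expR (- (x * 2 * cosh t)) * (x * sinh t))).
    exact: continuous_kernelM.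
  by apply/funext => t; rewrite mulrC.
have LC t : 0 <= t -> `|L t| <= expR ((0 + 1) ^+ 2 / x) * expR (- t).
  move=> t0; have /andP[L0 Lk] := Lle t t0; rewrite ger0_norm//.
  apply: le_trans Lk _; have := kC x t x0 t0.
  by rewrite mulr1 ger0_norm ?expR_ge0.
have F0 : F t @[t --> +oo] --> 0.
  apply: (cvg0_le_expRN _ (2^-1 * expR ((0 + 1) ^+ 2 / (x * 2)))) => t t0.
  rewrite /F -[leRHS]mulrA normrM normrN.
  rewrite [`|2^-1|]ger0_norm ?invr_ge0// ler_wpM2l ?invr_ge0//.
  by have := kC (x * 2) t; rewrite mulr1; apply => //; rewrite mulr_gt0.
have LE := Rintegral_derive _ _ _ _ dF cL LC F0.
have : 0 < \int[mu]_(t in halfline) L t.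
  by rewrite LE sub0r /F mulNr opprK mulr_gt0 ?expR_gt0// invr_gt0.
move=> /lt_le_trans; apply; apply: le_Rintegral => //.
- exact: integrable_le_expRN LC.
- exact: integrable_besselK.
- move=> t; rewrite /= in_itv/= andbT => /Lle/andP[_ Lk].
  by rewrite (le_trans Lk)// ler_peMr ?expR_ge0// cosh_ge1.
Qed.

(** As [cosh t >= 1], raising [x] by [x - 1] costs the integrand at least the
    factor [exp (- (x - 1))]. *)
Lemma besselK_decay nu x : 1 <= x ->
  besselK nu x <= expR (1 - x) * besselK nu 1.
Proof.
move=> x1; have x0 : 0 < x by lra.
have i1 : mu.-integrable halfline
    (EFin \o (fun t => expR (- (1 * cosh t)) * cosh (nu * t))).
  exact: integrable_besselK.
rewrite /besselK -RintegralZl//; apply: le_Rintegral => //.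
- exact: integrable_besselK.
- exact: (integrableZl _ _ i1).
- move=> t _; rewrite mulrA -expRD ler_pM2r ?cosh_gt0// ler_expR mul1r.
  have : 0 <= (x - 1) * (cosh t - 1) by rewrite mulr_ge0 ?subr_ge0// cosh_ge1.
  by lra.
Qed.

(** The values of [x * besselK nu x] come arbitrarily close to 0 at infinity;
    this is the only asymptotic information that the comparison needs. *)
Lemma mul_besselK_small nu x e : 0 < e ->
  exists2 y, x < y & y * besselK nu y < e.
Proof.
move=> e0; pose K := besselK nu 1; have K0 : 0 < K by exact: besselK_gt0.
have [T TE] : exists T, T = 2 * expR 1 * K / e by exists (2 * expR 1 * K / e).
have T0 : 0 < T by rewrite TE divr_gt0// !mulr_gt0// expR_gt0.
(* From [y^2 < 2 exp y], [y exp (1 - y) K < 2 exp 1 K / y], which is below the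
   target once [y > T]. *)
pose y := `|x| + 1 + T.
have y1 : 1 < y by rewrite /y; have := normr_ge0 x; lra.
have y0 : 0 < y by lra.
exists y; first by rewrite /y; have := ler_norm x; lra.
apply: (@le_lt_trans _ _ (y * (expR (1 - y) * K))).
  by rewrite ler_pM2l// besselK_decay// ltW.
have Ey := expR_gt0 y.
have yE : y ^+ 2 < 2 * expR y.
  by have := expR_ge1Dxn 1 (ltW y0); rewrite (_ : 2`!%:R = 2 :> R)//; lra.
rewrite expRD expRN.
rewrite (_ : _ * _ = y * (expR 1 * K) / expR y); last by ring.
rewrite ltr_pdivrMr//.
have ye : 2 * expR 1 * K < e * y.
  by rewrite [ltRHS]mulrC -ltr_pdivrMr// -TE /y; have := normr_ge0 x; lra.
rewrite -(ltr_pM2l (ltr0n _ 2)).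
apply: (@lt_trans _ _ (e * y ^+ 2)).
  rewrite (_ : 2 * (y * (expR 1 * K)) = 2 * expR 1 * K * y); last by ring.
  by rewrite expr2 mulrA ltr_pM2r.
by rewrite [ltRHS]mulrCA ltr_pM2l.
Qed.

End besselK_size.

(** * The bound for the ratio *)

Theorem theorem7 (R : realType) (lambda nu x : R)
  (hlambda : 0 <= lambda <= 1 / 2)
  (hnu : 1 / 2 - lambda <= nu)
  (hne : (lambda, nu) <> (0, 1 / 2))
  (hx : 0 < x) :
  besselK (nu + 1) x / besselK nu x
    < Bfun (alphaK nu lambda) (betaK nu lambda) 1 x.
Proof.
move/andP: hlambda => [l0 l1].
set alpha := alphaK nu lambda; set beta := betaK nu lambda.
pose p := Num.sqrt (2 * lambda).
pose q := Num.sqrt (nu ^+ 2 - (lambda - 1 / 2) ^+ 2).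
have pE : p ^+ 2 = 2 * lambda by rewrite sqr_sqrtr// mulr_ge0.
have qE : q ^+ 2 = nu ^+ 2 - (lambda - 1 / 2) ^+ 2.
  rewrite sqr_sqrtr// (_ : _ - _ = (nu - (1 / 2 - lambda)) * (nu + (1 / 2 - lambda))).
    by rewrite mulr_ge0 ?subr_ge0//; lra.
  by ring.
have betaE : beta = - p + q by [].
pose s y := Num.sqrt (beta ^+ 2 + 1 ^+ 2 * y ^+ 2).
have sE y : s y ^+ 2 = beta ^+ 2 + y ^+ 2.
  by rewrite sqr_sqrtr expr1n mul1r// addr_ge0// sqr_ge0.
have s0 y : 0 < y -> 0 < s y.
  by move=> y0; rewrite sqrtr_gt0 expr1n mul1r ltr_wpDl ?sqr_ge0// exprn_gt0.
pose W y := (alpha + s y) * besselK nu y - y * besselK (nu + 1) y.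
pose a y := (s y + (1 / 2 + lambda)) / y.
pose h y := besselK nu y * (p * s y - beta) ^+ 2 / (s y * y).
have dW (y : R) : 0 < y -> is_derive y 1 W (a y * W y - h y).
  move=> y0; have sy0 := s0 y y0.
  have dK0 := is_derive_besselK_raise nu y y0.
  have dK1 := is_derive_besselK_lower (nu + 1) y y0; rewrite addrK in dK1.
  have ds : is_derive y 1 s (y / s y) := is_derive_sqrt_sqrD R beta y y0.
  have das := is_deriveD (is_derive_cst alpha y (1 : R)) ds.
  apply: is_derive_eq (is_deriveB (is_deriveM das dK0)
    (is_deriveM (is_derive_id y 1) dK1)) _.
  have b2 : beta ^+ 2 = s y ^+ 2 - y ^+ 2 by rewrite sE addrK.
  (* The part free of [s] in [b^2 - 2 nu b - y^2 - y b'] is the cross term of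
     the square; this is what determines [beta]. *)
  have pb : - 2 * p * beta = (1 / 2 + lambda) ^+ 2 - nu ^+ 2 + beta ^+ 2.
    transitivity (p ^+ 2 - q ^+ 2 + beta ^+ 2); first by rewrite betaE; ring.
    by rewrite pE qE; field.
  have hE : (p * s y - beta) ^+ 2 = 2 * lambda * s y ^+ 2 +
      s y * ((1 / 2 + lambda) ^+ 2 - nu ^+ 2 + (s y ^+ 2 - y ^+ 2)) +
      (s y ^+ 2 - y ^+ 2).
    transitivity (p ^+ 2 * s y ^+ 2 + s y * (- 2 * p * beta) + beta ^+ 2).
      by ring.
    by rewrite pE pb b2.
  rewrite /GRing.scale/= /a /W /h hE /alpha /alphaK.
  rewrite -[(cst _ + s) y]/(nu + 1 / 2 + lambda + s y).
  have sn : s y != 0 by rewrite gt_eqF.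
  move: (s y) sn (besselK nu y) (besselK (nu + 1) y) => S Sn K L.
  by field; rewrite Sn gt_eqF.
have W0 : forall y, 0 < y -> 0 < W y.
  apply: (linear_ode_positive _ W _ a h _ dW).
  - by move=> y y0; exact: (is_derive_integrating_exponent R beta _ y y0).
  - by move=> y y0; rewrite divr_ge0 ?(ltW y0)//; have := s0 y y0; lra.
  - move=> y y0; apply: divr_ge0; apply: mulr_ge0; rewrite ?sqr_ge0// ltW//.
      exact: besselK_gt0.
    exact: s0.
  - have hgt0 y : 0 < y -> p * s y != beta -> 0 < h y.
      move=> y0 ne; rewrite divr_gt0// mulr_gt0 ?s0 ?besselK_gt0//.
      by rewrite exprn_even_gt0//= subr_eq0.
    (* As [s] is injective, [p s = beta] at two points forces [p = beta = 0]. *)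
    move=> y y0.
    have [E1|ne] := eqVneq (p * s (y + 1)) beta; last first.
      by exists (y + 1); [|apply: hgt0 => //]; lra.
    have [E2|ne] := eqVneq (p * s (y + 2)) beta; last first.
      by exists (y + 2); [|apply: hgt0 => //]; lra.
    have p0 : p = 0.
      apply/eqP; apply: contraT => pn.
      have sS : s (y + 1) = s (y + 2) by apply: (mulfI pn); rewrite E1 E2.
      by have := sE (y + 1); rewrite sS sE => /addrI; nra.
    have l00 : lambda = 0 by move: pE; rewrite p0 expr0n/=; lra.
    have q0 : q = 0.
      by move: betaE; rewrite -E1 p0 mul0r oppr0 add0r.
    exfalso; apply: hne; congr pair => //.
    by move: qE; rewrite q0 expr0n/= l00; nra.
  - move=> y e e0.
    have [z yz zK] := mul_besselK_small (nu + 1) (Num.max y 1) e e0.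
    move: yz; rewrite gt_max => /andP[yz z1]; exists z => //.
    have z0 : 0 < z by lra.
    have : 0 < (alpha + s z) * besselK nu z.
      rewrite mulr_gt0 ?besselK_gt0//; have := s0 z z0.
      by rewrite /alpha /alphaK; lra.
    by rewrite /W => W1; rewrite -[- e]add0r; apply: ltrD => //; rewrite ltrN2.
rewrite /Bfun ltr_pdivrMr ?besselK_gt0// mulrAC ltr_pdivlMr//.
by rewrite mulrC -subr_gt0; exact: W0.
Qed.
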